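(* Let $n=8$, $b_{max,2}=\frac1{18}$ and $\tilde b_{max,2}=\frac1{40}$. Then $C(b_{max,2})=\tilde C(\tilde b_{max,2})$ as subsets of $\mathcal{C}_B(\mathbb{R}^8)$, where $C(b)$ and $\tilde C(b)$ are the cones defined in the context.
   Context: $\mathcal{C}_B(\mathbb{R}^n)$ is the space of algebraic curvature operators: symmetric bilinear forms $R$ on $\Lambda^2\mathbb{R}^n$ satisfying the first Bianchi identity, with components $R_{ijkl}=R(e_i\wedge e_j,e_k\wedge e_l)$ in an orthonormal frame, $\mathrm{Ric}(R)_{ik}=\sum_p R_{ipkp}$, $\mathrm{scal}(R)=\sum_i\mathrm{Ric}(R)_{ii}$. Elements $T\in S^2(\mathfrak{so}(n))$ are symmetric bilinear forms on $\Lambda^2\mathbb{R}^n$ (Bianchi not required), with the same component notation. For symmetric two-tensors, $(A\wedge B)_{ijkl}=A_{ik}B_{jl}+A_{jl}B_{ik}-A_{il}B_{jk}-A_{jk}B_{il}$; $I=\frac12\,\mathrm{id}\wedge\mathrm{id}$. For $0\le b\le a$, $l_{a,b}(R)=R+b\,\mathrm{Ric}(R)\wedge\mathrm{id}+\frac{2(a-b)}{n}\mathrm{scal}(R)\,I$. Here $n=8$ throughout. First cone family. Put $\varepsilon=10^{-3}$. For $0<b\le b_{max,2}=\frac1{18}$ let $$a(b)=\frac{(2+(n-2)b)^2}{2(2+(n-3)b)}b,\qquad \gamma(b)=\frac{b}{2+(n-3)b},$$ $$\rho(b)=b-\frac{2(n-1)\gamma(1-2b)}{n^2}-\frac{2(n-1)(1+\gamma)\bigl(n^2b^2-2(n-1)(a-b)(1-2b)\bigr)}{n^2(1+2(n-1)a)},$$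 $$\omega(b)=(1-\varepsilon)\sqrt{\frac{27(2+(n-2)b)}{8}\,\frac{b(1+(n-2)b)^2}{n^2\rho^3(2+(n-3)b)^2}}.$$ A tensor $T\in S^2(\mathfrak{so}(n))$ lies in $C_{PIC}$ (relaxed sense) if $T_{1313}+T_{1414}+T_{2323}+T_{2424}+2T_{1342}+2T_{1423}\ge0$ for every orthonormal four-frame. $T\ge0$ means nonnegative definite on $\Lambda^2\mathbb{R}^n$. $\mathcal{E}(b)$ is the set of all $S\in\mathcal{C}_B(\mathbb{R}^n)$ for which there exists $T\in S^2(\mathfrak{so}(n))$ with: (1) $T\ge0$; (2) $S-T\in C_{PIC}$ in the relaxed sense; (3) $\mathrm{Ric}(S)_{11}+\mathrm{Ric}(S)_{22}+\frac{2\gamma(b)}{n}\mathrm{scal}(S)\ge0$ for every orthonormal pair; (4) for every orthonormal frame, $\mathrm{Ric}(S)_{22}-\mathrm{Ric}(S)_{11}\le\omega(b)^{1/2}\mathrm{scal}(S)^{1/2}\bigl(\sum_{p=3}^n(T_{1p1p}+T_{2p2p})\bigr)^{1/2}$. Put $C(b)=l_{a(b),b}(\mathcal{E}(b))$. Second cone family. For $0<b\le\tilde b_{max,2}=\frac1{40}$ let $\tilde a=b+\frac{n-2}{2}b^2$. $\tilde{\mathcal{E}}(b)$ is the set of all $S\in\mathcal{C}_B(\mathbb{R}^n)$ such that (i) $l_{\tilde a,b}(S)\in C(b_{max,2})$, and (ii) $$S_{1313}+\lambda^2S_{1414}+S_{2323}+\lambda^2S_{2424}-2\lambda S_{1234}+\sqrt{2\tilde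 a}\,(1-\lambda^2)\bigl(\mathrm{Ric}(S)_{11}+\mathrm{Ric}(S)_{22}\bigr)\ge0$$ for every orthonormal four-frame $\{e_1,e_2,e_3,e_4\}$ and every $\lambda\in[0,1]$. Then $\tilde C(b)=l_{\tilde a,b}(\tilde{\mathcal{E}}(b))$. *)

(* Defs.v *)
From HB Require Import structures.
From mathcomp Require Import all_boot all_order all_algebra.
From mathcomp Require Import all_classical all_reals.

Set Implicit Arguments.
Unset Strict Implicit.
Unset Printing Implicit Defensive.

Import Order.TTheory GRing.Theory Num.Theory.
Local Open Scope classical_set_scope.
Local Open Scope ring_scope.

(* Frame vectors e_1, ..., e_4 carry the ordinals 0, ..., 3. The numerals are
   taken modulo m in 'I_m: use i3 and i4 only when m >= 4. *)
Notation i1 := (0%R : 'I__) (only parsing).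
Notation i2 := (1%R : 'I__) (only parsing).
Notation i3 := (2%:R : 'I__) (only parsing).
Notation i4 := (3%:R : 'I__) (only parsing).

Section Tensors.
Variables (R : realType) (n : nat).

(* T i j k l stands for T(e_i /\ e_j, e_k /\ e_l), with e the standard basis
   of R^n; the symmetries are imposed by [S2so] and [CB] below. *)
Definition tensor4 := 'I_n -> 'I_n -> 'I_n -> 'I_n -> R.

(* Symmetric bilinear forms on Lambda^2 R^n. Antisymmetry in the second pair
   follows from the other two identities. *)
Definition S2so : set tensor4 :=
  [set T | (forall i j k l, T i j k l = - T j i k l) /\
           (forall i j k l, T i j k l = T k l i j)].

Definition CB : set tensor4 :=
  [set S | S2so S /\
           forall i j k l, S i j k l + S j k i l + S k i j l = 0].

Definition tensor_sub (S T : tensor4) : tensor4 :=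
  fun i j k l => S i j k l - T i j k l.

Definition Ric (S : tensor4) : 'M[R]_n :=
  \matrix_(i, k) \sum_p S i p k p.

Definition scal (S : tensor4) : R := \sum_i Ric S i i.

Definition kn (A B : 'M[R]_n) : tensor4 := fun i j k l =>
  A i k * B j l + A j l * B i k - A i l * B j k - A j k * B i l.

Definition tensor_I : tensor4 := fun i j k l => 2^-1 * kn 1%:M 1%:M i j k l.

Definition lmap (a b : R) (S : tensor4) : tensor4 := fun i j k l =>
  S i j k l + b * kn (Ric S) 1%:M i j k l
  + 2 * (a - b) / n%:R * scal S * tensor_I i j k l.

(* The form is evaluated at phi = \sum_(i < j) phi_ij e_i /\ e_j, a general
   element of Lambda^2 R^n; only the entries phi_ij with i < j matter. *)
Definition nonneg_def (T : tensor4) : Prop :=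
  forall phi : 'M[R]_n,
    0 <= \sum_(i < n) \sum_(j < n | (i < j)%N) \sum_(k < n) \sum_(l < n | (k < l)%N)
           phi i j * phi k l * T i j k l.

End Tensors.

Section Frames.
Variables (R : realType) (n m : nat).

(* The vectors of an m-frame are the rows of an m x n matrix. *)
Definition orthonormal (e : 'M[R]_(m, n)) : Prop := e *m e^T = 1%:M.

Definition in_frame (e : 'M[R]_(m, n)) (T : tensor4 R n) : tensor4 R m :=
  fun i j k l => \sum_p \sum_q \sum_r \sum_s
    e i p * e j q * e k r * e l s * T p q r s.

(* Ric(S)(e_i, e_k); e need not be a basis of R^n, so this is not
   Ric (in_frame e S) in general. *)
Definition Ric_in (e : 'M[R]_(m, n)) (S : tensor4 R n) (i k : 'I_m) : R :=
  \sum_p \sum_q e i p * e k q * Ric S p q.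

End Frames.

Section PIC.
Variables (R : realType) (n : nat).

(* Not assuming the Bianchi identity, hence the two terms 1342 and 1423 in
   place of -2 T_1234. *)
Definition CPIC : set (tensor4 R n) :=
  [set T | S2so T /\
    forall e : 'M[R]_(4, n), orthonormal e ->
      let T' := in_frame e T in
      0 <= T' i1 i3 i1 i3 + T' i1 i4 i1 i4 + T' i2 i3 i2 i3 + T' i2 i4 i2 i4
           + 2 * T' i1 i3 i4 i2 + 2 * T' i1 i4 i2 i3].

End PIC.

Section Cones.
Variable R : realType.

Local Notation dim := 8%N.
Local Notation n := (dim%:R : R).

Definition epsilon : R := 10 ^- 3.

Definition bmax2 : R := 1 / 18.

Definition a_ (b : R) : R :=
  (2 + (n - 2) * b) ^+ 2 / (2 * (2 + (n - 3) * b)) * b.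

Definition gamma (b : R) : R := b / (2 + (n - 3) * b).

Definition rho (b : R) : R :=
  b - 2 * (n - 1) * gamma b * (1 - 2 * b) / n ^+ 2
  - 2 * (n - 1) * (1 + gamma b)
      * (n ^+ 2 * b ^+ 2 - 2 * (n - 1) * (a_ b - b) * (1 - 2 * b))
    / (n ^+ 2 * (1 + 2 * (n - 1) * a_ b)).

Definition omega (b : R) : R :=
  (1 - epsilon) *
  Num.sqrt (27 * (2 + (n - 2) * b) / 8 *
            (b * (1 + (n - 2) * b) ^+ 2
             / (n ^+ 2 * rho b ^+ 3 * (2 + (n - 3) * b) ^+ 2))).

Definition E (b : R) : set (tensor4 R dim) :=
  [set S | CB S /\ exists T : tensor4 R dim, S2so T /\
    [/\ nonneg_def T,
        CPIC (tensor_sub S T),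
        (forall e : 'M[R]_(2, dim), orthonormal e ->
           0 <= Ric_in e S i1 i1 + Ric_in e S i2 i2
                + 2 * gamma b / n * scal S)
      & (forall e : 'M[R]_dim, orthonormal e ->
           let T' := in_frame e T in
           Ric_in e S i2 i2 - Ric_in e S i1 i1 <=
             Num.sqrt (omega b) * Num.sqrt (scal S) *
             Num.sqrt (\sum_(p < dim | (2 <= p)%N)
                         (T' i1 p i1 p + T' i2 p i2 p)))]].

Definition C (b : R) : set (tensor4 R dim) := lmap (a_ b) b @` E b.

Definition btmax2 : R := 1 / 40.

Definition at_ (b : R) : R := b + (n - 2) / 2 * b ^+ 2.

Definition Et (b : R) : set (tensor4 R dim) :=
  [set S | [/\ CB S,
    C bmax2 (lmap (at_ b) b S)
  & forall (e : 'M[R]_(4, dim)) (lambda : R),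
      orthonormal e -> 0 <= lambda <= 1 ->
      let S' := in_frame e S in
      0 <= S' i1 i3 i1 i3 + lambda ^+ 2 * S' i1 i4 i1 i4
           + S' i2 i3 i2 i3 + lambda ^+ 2 * S' i2 i4 i2 i4
           - 2 * lambda * S' i1 i2 i3 i4
           + Num.sqrt (2 * at_ b) * (1 - lambda ^+ 2)
             * (Ric_in e S i1 i1 + Ric_in e S i2 i2)]].

Definition Ct (b : R) : set (tensor4 R dim) := lmap (at_ b) b @` Et b.

End Cones.

(* Main.v *)
From mathcomp Require Import all_boot all_order all_algebra.
From mathcomp Require Import all_classical all_reals.
From mathcomp Require Import ring lra.
Require Import Defs.

(** The map l_{a,b} inverts explicitly, so C(1/18) = l_{at,1/40}(S) with
    S = l_{a',b'}(U), U in E(1/18), b' = 11/414, and everything reduces to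
    condition (ii) for S. With W = U - T, the PIC inequality of the frame
    (e1, e2, e3, x e4 + y e_q), x^2 + y^2 = 1, averaged over the sign of y and
    over q >= 5, bounds the curvature terms of (ii) for U from below; taking it
    with weight 3/4, and coordinate frames (y = 0 or x = 0) with weight 1/4,
    makes the bound on (ii) for S a combination, with coefficients nonnegative
    on [0, 1], of its value at x = 1, nonnegative by condition (3), of a PIC
    expression, and of a single linear form in the sectional values W_ijij,
    T_ijij. That form is nonnegative by linear programming: besides PIC in
    coordinate frames and T >= 0 one needs condition (4) for the pairs (e1, e3)
    and (e2, e3), linearised by
    2 sqrt (omega scal X) <= omega scal / 28 + 28 X. *)

Set Implicit Arguments.
Unset Strict Implicit.
Unset Printing Implicit Defensive.

Import Order.TTheory GRing.Theory Num.Theory.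
Local Open Scope classical_set_scope.
Local Open Scope ring_scope.

(** * Completion of orthonormal frames *)

Section OrthonormalCompletion.
Variable R : realType.

Lemma orthonormal_col_mx (m p n : nat) (A : 'M[R]_(m, n)) (B : 'M[R]_(p, n)) :
  orthonormal (col_mx A B) <->
  [/\ A *m A^T = 1%:M, A *m B^T = 0 & B *m B^T = 1%:M].
Proof.
rewrite /orthonormal tr_col_mx mul_col_row (scalar_mx_block m p).
split=> [/eq_block_mx[-> -> _ ->] //|[-> AB ->]].
by rewrite AB -[B *m A^T]trmxK trmx_mul trmxK AB trmx0.
Qed.

Lemma unit_normal_vector (m n : nat) (e : 'M[R]_(m, n)) :
  (m < n)%N -> exists v : 'rV[R]_n, v *m e^T = 0 /\ v *m v^T = 1%:M.
Proof.
move=> lt_mn.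
have /rowV0Pn[v /sub_kermxP ve v0] : kermx e^T != 0.
  rewrite -mxrank_eq0 mxrank_ker -lt0n subn_gt0.
  by rewrite (leq_ltn_trans _ lt_mn)// mxrank_tr rank_leq_row.
pose s := \sum_p v 0 p ^+ 2.
have s_gt0 : 0 < s.
  rewrite lt_neqAle sumr_ge0 ?andbT; last by move=> p _; exact: sqr_ge0.
  apply: contra v0; rewrite eq_sym psumr_eq0; last by move=> p _; exact: sqr_ge0.
  move=> /allP s0; apply/eqP/rowP => p; rewrite mxE.
  by have := s0 p; rewrite mem_index_enum sqrf_eq0 => /(_ isT)/eqP.
exists ((Num.sqrt s)^-1 *: v); split; first by rewrite -scalemxAl ve scaler0.
apply/matrixP => i j; rewrite !ord1 linearZ/= -scalemxAl -scalemxAr scalerA !mxE.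
rewrite -invfM -expr2 sqr_sqrtr ?ltW//.
under eq_bigr do rewrite mxE -expr2.
by rewrite -/s mulVf ?eqxx ?gt_eqF.
Qed.

(** Condition (ii) speaks of four-frames, while condition (4) and the Ricci traces need a full
    frame. Unit vectors normal to all previous ones are added one at a time. *)
Lemma orthonormal_completion (m n d : nat) (e : 'M[R]_(m, n)) :
  orthonormal e -> (m + d <= n)%N ->
  exists g : 'M[R]_(d, n), orthonormal (col_mx e g).
Proof.
move=> oe; elim: d => [_|d IHd].
  by exists 0; apply/orthonormal_col_mx; split; rewrite ?trmx0 ?mulmx0//;
    apply/matrixP => -[].
move=> le_n; have lt_n : (m + d < n)%N by rewrite -addnS.
have [g og] := IHd (ltnW lt_n).
have [v [vf vv]] := unit_normal_vector (col_mx e g) lt_n.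
have /orthonormal_col_mx[_ eg gg] := og.
move: vf; rewrite tr_col_mx mul_mx_row -row_mx0 => /eq_row_mx[ve vg].
have o1 : orthonormal (col_mx e (col_mx v g)).
  apply/orthonormal_col_mx; split=> //; last exact/orthonormal_col_mx.
  by rewrite tr_col_mx mul_mx_row eg -[e *m v^T]trmxK trmx_mul trmxK ve trmx0 row_mx0.
by exists (col_mx v g).
Qed.

End OrthonormalCompletion.

(** * Curvature tensors evaluated on arbitrary vectors *)

Section Evaluation.
Variables (R : realType) (n : nat).
Implicit Types (T W : tensor4 R n) (u v w z : 'rV[R]_n).

(** Unlike [in_frame], this accepts any vectors, so a frame containing x e4 + y e_q can be expanded
    by multilinearity. *)
Definition ev T u v w z : R := \sum_p \sum_q \sum_r \sum_s
  u 0 p * v 0 q * w 0 r * z 0 s * T p q r s.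

Lemma in_frameE (m : nat) (e : 'M[R]_(m, n)) T i j k l :
  in_frame e T i j k l = ev T (row i e) (row j e) (row k e) (row l e).
Proof.
rewrite /in_frame /ev; do 4 (apply: eq_bigr => ? _); by rewrite !mxE.
Qed.

Lemma ev_lin1 T (x y : R) u u' v w z :
  ev T (x *: u + y *: u') v w z = x * ev T u v w z + y * ev T u' v w z.
Proof.
rewrite /ev; do 4 (rewrite !mulr_sumr -big_split/=; apply: eq_bigr => ? _).
by rewrite !mxE; ring.
Qed.

Lemma ev_antisym T : S2so T -> forall u v w z, ev T u v w z = - ev T v u w z.
Proof.
move=> [Ta _] u v w z; rewrite /ev exchange_big/= -sumrN.
do 3 (apply: eq_bigr => ? _; rewrite -sumrN); apply: eq_bigr => ? _.
by rewrite Ta; ring.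
Qed.

Lemma ev_pair T : S2so T -> forall u v w z, ev T u v w z = ev T w z u v.
Proof.
move=> [_ Ts] u v w z; rewrite /ev.
under eq_bigr do under eq_bigr do rewrite pair_bigA/=.
under [RHS]eq_bigr do under eq_bigr do rewrite pair_bigA/=.
rewrite [LHS]pair_bigA [RHS]pair_bigA exchange_big/=.
do 2 (apply: eq_bigr => ? _); by rewrite Ts; ring.
Qed.

(** Antisymmetry moves slot 2 to slot 1, and the pair symmetry moves slots 3 and 4 to slots 1 and 2,
    so linearity in the first slot gives the rest. *)
Lemma ev_lin2 T : S2so T -> forall (x y : R) u v v' w z,
  ev T u (x *: v + y *: v') w z = x * ev T u v w z + y * ev T u v' w z.
Proof.
move=> hT x y u v v' w z; rewrite (ev_antisym hT) ev_lin1.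
by rewrite (ev_antisym hT v) (ev_antisym hT v'); ring.
Qed.

Lemma ev_lin3 T : S2so T -> forall (x y : R) u v w w' z,
  ev T u v (x *: w + y *: w') z = x * ev T u v w z + y * ev T u v w' z.
Proof. by move=> hT x y u v w w' z; rewrite !(ev_pair hT u v) ev_lin1. Qed.

Lemma ev_lin4 T : S2so T -> forall (x y : R) u v w z z',
  ev T u v w (x *: z + y *: z') = x * ev T u v w z + y * ev T u v w z'.
Proof. by move=> hT x y u v w z z'; rewrite !(ev_pair hT u v) ev_lin2. Qed.

Lemma ev_sub S T u v w z :
  ev (tensor_sub S T) u v w z = ev S u v w z - ev T u v w z.
Proof.
rewrite /ev/tensor_sub.
do 4 (rewrite -sumrB; apply: eq_bigr => ? _); by rewrite mulrBr.
Qed.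

Lemma ev_bianchi S : CB S -> forall u v w z,
  ev S u v w z + ev S v w u z + ev S w u v z = 0.
Proof.
move=> [_ Sb] u v w z.
(* Both cyclic terms are reindexed to the common coefficient u_p v_q w_r z_s, after which the
   Bianchi identity applies termwise. *)
have -> : ev S v w u z = \sum_p \sum_q \sum_r \sum_s
    u 0 p * v 0 q * w 0 r * z 0 s * S q r p s.
  rewrite /ev; under eq_bigr do rewrite exchange_big/=.
  rewrite exchange_big/=; do 4 (apply: eq_bigr => ? _); ring.
have -> : ev S w u v z = \sum_p \sum_q \sum_r \sum_s
    u 0 p * v 0 q * w 0 r * z 0 s * S r p q s.
  rewrite /ev exchange_big/=; apply: eq_bigr => ? _.
  rewrite exchange_big/=; do 3 (apply: eq_bigr => ? _); ring.
rewrite /ev -2!big_split/= big1// => p _.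
rewrite -2!big_split/= big1// => q _.
rewrite -2!big_split/= big1// => r _.
rewrite -2!big_split/= big1// => s _.
by rewrite -!mulrDr Sb mulr0.
Qed.

Lemma sum_antisym (p g : 'I_n -> 'I_n -> R) :
  (forall a b, g a b = - g b a) ->
  \sum_a \sum_b p a b * g a b =
  \sum_(a < n) \sum_(b < n | (a < b)%N) (p a b - p b a) * g a b.
Proof.
move=> ga; have g0 a : g a a = 0 by have := ga a a; lra.
have -> : \sum_a \sum_b p a b * g a b =
    \sum_(a < n) \sum_(b < n | (a < b)%N) p a b * g a b
    + \sum_(a < n) \sum_(b < n | (b < a)%N) p a b * g a b.
  rewrite -big_split/=; apply: eq_bigr => a _.
  rewrite (bigID (fun b : 'I_n => (a < b)%N))/=; congr (_ + _).
  rewrite (bigD1 a) ?ltnn//= g0 mulr0 add0r; apply: eq_bigl => b.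
  by rewrite -leqNgt ltn_neqAle andbC.
have -> : \sum_(a < n) \sum_(b < n | (b < a)%N) p a b * g a b =
    \sum_(a < n) \sum_(b < n | (a < b)%N) p b a * g b a.
  by rewrite (exchange_big_dep predT).
rewrite -big_split; apply: eq_bigr => a _; rewrite -big_split; apply: eq_bigr => b _.
by rewrite /= (ga b a); ring.
Qed.

(** By antisymmetry of T, the full sum for p equals the sum over ordered index pairs for p - p^T,
    where [nonneg_def] applies. *)
Lemma nonneg_defE T (p : 'M[R]_n) : S2so T -> nonneg_def T ->
  0 <= \sum_a \sum_b \sum_c \sum_d p a b * p c d * T a b c d.
Proof.
move=> [Ta Ts] /(_ (p - p^T)) /le_trans; apply.
rewrite le_eqVlt; apply/orP; left; apply/eqP; symmetry.
transitivity (\sum_a \sum_b p a b * \sum_c \sum_d p c d * T a b c d).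
  do 2 (apply: eq_bigr => ? _); rewrite mulr_sumr; apply: eq_bigr => ? _.
  by rewrite mulr_sumr; apply: eq_bigr => ? _; rewrite mulrA.
rewrite sum_antisym; last first.
  move=> a b; rewrite -sumrN; apply: eq_bigr => c _; rewrite -sumrN.
  by apply: eq_bigr => d _; rewrite Ta mulrN.
do 2 (apply: eq_bigr => ? _).
rewrite sum_antisym; last by move=> a b; rewrite Ts Ta -Ts.
rewrite mulr_sumr; apply: eq_bigr => ? _; rewrite mulr_sumr; apply: eq_bigr => ? _.
by rewrite !mxE mulrA.
Qed.

(** The form is tested on the bivector u /\ v + x w /\ z. *)
Lemma ev_psd T : S2so T -> nonneg_def T -> forall (x : R) u v w z,
  0 <= ev T u v u v + x ^+ 2 * ev T w z w z + 2 * x * ev T u v w z.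
Proof.
move=> hT pT x u v w z.
have := nonneg_defE (\matrix_(a, b) (u 0 a * v 0 b + x * (w 0 a * z 0 b))) hT pT.
congr (_ <= _).
have -> : 2 * x * ev T u v w z = x * ev T u v w z + x * ev T w z u v.
  by rewrite (ev_pair hT w); ring.
rewrite /ev.
rewrite !addrA; do 4 (rewrite !mulr_sumr -!big_split/=; apply: eq_bigr => ? _).
by rewrite !mxE; ring.
Qed.

Lemma row_orthonormal (m : nat) (e : 'M[R]_(m, n)) i j : orthonormal e ->
  (row i e *m (row j e)^T) 0 0 = (i == j)%:R.
Proof.
move=> oe; transitivity ((e *m e^T) i j); last by rewrite oe mxE.
by rewrite !mxE; apply: eq_bigr => ? _; rewrite !mxE.
Qed.

Lemma CPIC_ev W (e : 'M[R]_(4, n)) : CPIC W -> orthonormal e ->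
  let u := row 0 e in let v := row 1 e in
  let w := row 2%:R e in let z := row 3%:R e in
  0 <= ev W u w u w + ev W u z u z + ev W v w v w + ev W v z v z
       + 2 * ev W u w z v + 2 * ev W u z v w.
Proof. by move=> [_ +] oe => /(_ _ oe)/=; rewrite !in_frameE. Qed.

End Evaluation.

(** * The PIC inequality in rotated frames *)

Section Isotropic.
Variables (R : realType) (m n : nat) (f : 'M[R]_(m, n)).
Hypothesis orth_f : orthonormal f.

Lemma rowsub_orthonormal (p : nat) (g : 'I_p -> 'I_m) :
  injective g -> orthonormal (rowsub g f).
Proof.
move=> g_inj; apply/matrixP => i j; transitivity ((f *m f^T) (g i) (g j)).
  by rewrite !mxE; apply: eq_bigr => ? _; rewrite !mxE.
by rewrite orth_f !mxE (inj_eq g_inj).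
Qed.

Lemma in_frame_rowsub (p : nat) (g : 'I_p -> 'I_m) (T : tensor4 R n) i j k l :
  in_frame (rowsub g f) T i j k l = in_frame f T (g i) (g j) (g k) (g l).
Proof. by rewrite /in_frame; do 4 (apply: eq_bigr => ? _); rewrite !mxE. Qed.

Definition rotated (i j k l q : 'I_m) (x y : R) : 'M[R]_(4, n) :=
  \matrix_(a < 4) nth 0
    [:: row i f; row j f; row k f; x *: row l f + y *: row q f] a.

Lemma rotated_orthonormal (i j k l q : 'I_m) (x y : R) :
  uniq [:: i; j; k; l; q] -> x ^+ 2 + y ^+ 2 = 1 ->
  orthonormal (rotated i j k l q x y).
Proof.
move=> ijklq xy.
pose dot (u v : 'rV[R]_n) := (u *m v^T) 0 0.
have dotE a b : dot (row a f) (row b f) = (a == b)%:R by exact: row_orthonormal.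
have dotl s t (u v w : 'rV[R]_n) : dot (s *: u + t *: v) w = s * dot u w + t * dot v w.
  by rewrite /dot mulmxDl -!scalemxAl !mxE.
have dotC u v : dot u v = dot v u.
  by rewrite /dot !mxE; apply: eq_bigr => ? _; rewrite !mxE mulrC.
have dotr s t (u v w : 'rV[R]_n) : dot w (s *: u + t *: v) = s * dot w u + t * dot w v.
  by rewrite dotC dotl !(dotC w).
move: ijklq; rewrite /= !inE !negb_or -!andbA !andbT.
move=> /and5P[ij ik il iq /and5P[jk jl jq kl /andP[kq lq]]].
apply/matrixP => a b.
transitivity (dot (row a (rotated i j k l q x y)) (row b (rotated i j k l q x y))).
  by rewrite /dot !mxE; apply: eq_bigr => ? _; rewrite !mxE.
rewrite !rowK [RHS]mxE -val_eqE.
case: a b => -[|[|[|[|//]]]] ? [[|[|[|[|//]]]] ?] /=;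
  rewrite ?(dotl, dotr) ?(dotC (row j f) (row i f)) ?(dotC (row k f) (row i f))
  ?(dotC (row k f) (row j f)) ?(dotC (row l f) (row i f)) ?(dotC (row l f) (row j f))
  ?(dotC (row l f) (row k f)) ?(dotC (row q f)) !dotE ?eqxx.
all: rewrite ?(negPf ij) ?(negPf ik) ?(negPf il) ?(negPf iq) ?(negPf jk) ?(negPf jl)
  ?(negPf jq) ?(negPf kl) ?(negPf kq) ?(negPf lq) //=.
all: by rewrite ?(mulr0, add0r, addr0, mulr1)// -!expr2.
Qed.

Lemma CPIC_rotated (W : tensor4 R n) (i j k l q : 'I_m) (x y : R) :
  CPIC W -> uniq [:: i; j; k; l; q] -> x ^+ 2 + y ^+ 2 = 1 ->
  let w := in_frame f W in
  0 <= w i k i k + w j k j k + x ^+ 2 * (w i l i l + w j l j l)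
       + y ^+ 2 * (w i q i q + w j q j q) + 2 * x * (w i k l j + w i l j k).
Proof.
move=> pW ijklq xy; have [hW _] := pW.
have key s : x ^+ 2 + s ^+ 2 = 1 ->
  0 <= ev W (row i f) (row k f) (row i f) (row k f) +
  ev W (row i f) (x *: row l f + s *: row q f) (row i f) (x *: row l f + s *: row q f)
  + ev W (row j f) (row k f) (row j f) (row k f)
  + ev W (row j f) (x *: row l f + s *: row q f) (row j f) (x *: row l f + s *: row q f)
  + 2 * ev W (row i f) (row k f) (x *: row l f + s *: row q f) (row j f)
  + 2 * ev W (row i f) (x *: row l f + s *: row q f) (row j f) (row k f).
  by move=> xs; have := CPIC_ev pW (rotated_orthonormal ijklq xs); rewrite /= !rowK.
(* Adding the inequalities for y and -y cancels every term that mixes rows l and q, as well as the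
   terms linear in row q. *)
have := key (- y); rewrite sqrrN => /(_ xy); have := key y xy.
rewrite /= !in_frameE !(ev_lin2 hW, ev_lin3 hW, ev_lin4 hW).
move: (ev _ _ _ _ _) => *. lra.
Qed.

End Isotropic.

(** * Ricci and scalar traces, and the maps l_{a,b} *)

Section Trace.
Variables (R : realType) (n : nat).

Lemma Ric_inE (m : nat) (e : 'M[R]_(m, n)) (S : tensor4 R n) i k :
  Ric_in e S i k = (e *m Ric S *m e^T) i k.
Proof.
rewrite /Ric_in !mxE exchange_big/=; apply: eq_bigr => q _.
by rewrite !mxE mulr_suml; apply: eq_bigr => p _; rewrite !mxE; ring.
Qed.

Lemma Ric_in_rowsub (m p : nat) (f : 'M[R]_(m, n)) (g : 'I_p -> 'I_m)
  (S : tensor4 R n) i k : Ric_in (rowsub g f) S i k = Ric_in f S (g i) (g k).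
Proof. by rewrite /Ric_in; do 2 (apply: eq_bigr => ? _); rewrite !mxE. Qed.

Lemma Ric_in_frame (f : 'M[R]_n) (S : tensor4 R n) i k : orthonormal f ->
  Ric_in f S i k = \sum_p in_frame f S i p k p.
Proof.
move=> /mulmx1C orth_f.
(* Slots 1 and 3 are filled with rows i and k of f; [M] is the remaining form in slots 2 and 4, and
   its trace is unchanged by conjugation with f. *)
pose M := \matrix_(b, d) \sum_a \sum_c f i a * f k c * S a b c d.
transitivity (\tr M).
  rewrite /Ric_in /mxtrace; under [RHS]eq_bigr do rewrite mxE.
  rewrite [RHS]exchange_big/=; apply: eq_bigr => a _.
  rewrite [RHS]exchange_big/=; apply: eq_bigr => c _.
  by rewrite mxE mulr_sumr.
rewrite -[M]mulmx1 -orth_f mulmxA mxtrace_mulC mulmxA /mxtrace.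
apply: eq_bigr => p _; rewrite mxE /in_frame.
transitivity (\sum_b \sum_d \sum_a \sum_c f i a * f p b * f k c * f p d * S a b c d).
  rewrite exchange_big/=; apply: eq_bigr => d _.
  rewrite !mxE mulr_suml; apply: eq_bigr => b _.
  rewrite !mxE mulr_sumr mulr_suml; apply: eq_bigr => a _.
  by rewrite mulr_sumr mulr_suml; apply: eq_bigr => c _; ring.
under eq_bigr do rewrite exchange_big/=.
rewrite exchange_big/=; apply: eq_bigr => a _; apply: eq_bigr => b _.
by rewrite exchange_big.
Qed.

Lemma scal_in_frame (f : 'M[R]_n) (S : tensor4 R n) : orthonormal f ->
  scal S = \sum_i Ric_in f S i i.
Proof.
move=> /mulmx1C orth_f; under [RHS]eq_bigr do rewrite Ric_inE.
by rewrite -[RHS]/(\tr _) -mulmxA mxtrace_mulC -mulmxA orth_f mulmx1.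
Qed.

Lemma in_frame_kn (m : nat) (e : 'M[R]_(m, n)) (A B : 'M[R]_n) i j k l :
  in_frame e (kn A B) i j k l = kn (e *m A *m e^T) (e *m B *m e^T) i j k l.
Proof.
have sE (X : 'M[R]_n) a b : (e *m X *m e^T) a b = \sum_p \sum_q e a p * e b q * X p q.
  rewrite mxE exchange_big/=; apply: eq_bigr => q _.
  by rewrite !mxE mulr_suml; apply: eq_bigr => p _; ring.
(* The four terms of [kn] distribute the slots over the two factors in four ways; each of these
   identities expands one such product with the indices in the order used by [in_frame]. *)
have prod (F G : 'I_n -> 'I_n -> R) : (\sum_p \sum_q F p q) * (\sum_p \sum_q G p q) =
    \sum_p \sum_q \sum_r \sum_s F p r * G q s.
  rewrite mulr_suml; apply: eq_bigr => p _.
  rewrite mulr_sumr; apply: eq_bigr => q _.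
  rewrite mulr_suml; apply: eq_bigr => r _.
  by rewrite mulr_sumr; apply: eq_bigr => s _.
have prod' (F G : 'I_n -> 'I_n -> R) : (\sum_p \sum_q F p q) * (\sum_p \sum_q G p q) =
    \sum_p \sum_q \sum_r \sum_s F p s * G q r.
  rewrite prod; do 2 (apply: eq_bigr => ? _); exact: exchange_big.
have prodC (F G : 'I_n -> 'I_n -> R) : (\sum_p \sum_q F p q) * (\sum_p \sum_q G p q) =
    \sum_p \sum_q \sum_r \sum_s F q s * G p r.
  by rewrite mulrC prod; do 4 (apply: eq_bigr => ? _); rewrite mulrC.
have prodC' (F G : 'I_n -> 'I_n -> R) : (\sum_p \sum_q F p q) * (\sum_p \sum_q G p q) =
    \sum_p \sum_q \sum_r \sum_s F q r * G p s.
  by rewrite mulrC prod'; do 4 (apply: eq_bigr => ? _); rewrite mulrC.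
rewrite /kn !sE [X in X + _ - _ - _]prod [X in _ + X - _ - _]prodC.
rewrite [X in _ - X - _]prod' [X in _ - X]prodC' /in_frame.
do 4 (rewrite -big_split/= -!sumrB/=; apply: eq_bigr => ? _).
by rewrite /kn; ring.
Qed.

Lemma in_frame_lmap (m : nat) (e : 'M[R]_(m, n)) a b (S : tensor4 R n) i j k l :
  orthonormal e ->
  in_frame e (lmap a b S) i j k l = in_frame e S i j k l
    + b * kn (e *m Ric S *m e^T) 1%:M i j k l
    + (a - b) / n%:R * scal S * kn 1%:M 1%:M i j k l.
Proof.
move=> oe.
have eE : e *m 1%:M *m e^T = 1%:M by rewrite mulmx1.
rewrite -eE -!in_frame_kn /in_frame /lmap /tensor_I.
(* With the inverse of n made a variable, [field] raises no side condition on n, so n = 0 is covered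
   too. *)
move: (scal S) (n%:R^-1) => s t.
do 4 (rewrite !mulr_sumr -!big_split/=; apply: eq_bigr => ? _).
by field.
Qed.

Lemma Ric_lmap a b (S : tensor4 R n) : (0 < n)%N ->
  Ric (lmap a b S) = (1 + (n%:R - 2) * b) *: Ric S
    + ((b + 2 * (a - b) * (n%:R - 1) / n%:R) * scal S)%:M.
Proof.
move=> n_gt0; have n0 : n%:R != 0 :> R by rewrite pnatr_eq0 -lt0n.
have knT (A : 'M[R]_n) i k : \sum_p kn A 1%:M i p k p =
    (n%:R - 2) * A i k + \tr A * (i == k)%:R.
  rewrite /kn !(sumrB, big_split)/=.
  rewrite -[X in _ + X - _ - _]mulr_suml.
  rewrite [X in X + _ - _ - _](eq_bigr (fun=> A i k)); last first.
    by move=> p _; rewrite !mxE eqxx mulr1.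
  rewrite sumr_const card_ord.
  rewrite [X in _ - X - _](bigD1 k)//= [X in _ - (_ + X) - _]big1 ?addr0; last first.
    by move=> p pk; rewrite mxE (negPf pk) mulr0.
  rewrite [X in _ - X](bigD1 i)//= [X in _ - (_ + X)]big1 ?addr0; last first.
    by move=> p pk; rewrite mxE eq_sym (negPf pk) mulr0.
  by rewrite !mxE !eqxx /mxtrace -(mulr_natr (A i k)) /=; ring.
apply/matrixP => i k; rewrite !mxE /lmap /tensor_I !big_split/=.
rewrite -!mulr_sumr !knT mxtrace1 !mxE -[\tr _]/(scal S).
by rewrite -mulr_natr; field.
Qed.

Lemma scal_lmap a b (S : tensor4 R n) : (0 < n)%N ->
  scal (lmap a b S) = (1 + 2 * (n%:R - 1) * a) * scal S.
Proof.
move=> n_gt0; have n0 : n%:R != 0 :> R by rewrite pnatr_eq0 -lt0n.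
rewrite -[LHS]/(\tr _) Ric_lmap// linearD linearZ/= mxtrace_scalar.
by rewrite -[\tr _]/(scal S) -mulr_natr; field.
Qed.

Lemma Ric_in_lmap (f : 'M[R]_n) a b (S : tensor4 R n) i :
  (0 < n)%N -> orthonormal f ->
  Ric_in f (lmap a b S) i i = (1 + (n%:R - 2) * b) * Ric_in f S i i
    + (b + 2 * (a - b) * (n%:R - 1) / n%:R) * scal S.
Proof.
move=> n_gt0 orth_f; rewrite !Ric_inE Ric_lmap// mulmxDr mulmxDl.
by rewrite -scalemxAr -scalemxAl mul_mx_scalar -scalemxAl orth_f !mxE eqxx mulr1.
Qed.

Lemma kn_id_sectional (A : 'M[R]_n) i j : i != j ->
  kn A 1%:M i j i j = A i i + A j j.
Proof.
move=> ij; have id1 a b : (1%:M : 'M[R]_n) a b = (a == b)%:R by rewrite mxE.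
by rewrite /kn !id1 !eqxx (eq_sym j i) (negPf ij) /=; ring.
Qed.

(** Hence l_{a,b} leaves the component S_1234 in condition (ii) unchanged. *)
Lemma kn_id_distinct (A : 'M[R]_n) i j k l :
  uniq [:: i; j; k; l] -> kn A 1%:M i j k l = 0.
Proof.
move=> /=; rewrite !inE !negb_or -!andbA !andbT => /and5P[_ ik il jk /andP[jl _]].
have id1 a b : (1%:M : 'M[R]_n) a b = (a == b)%:R by rewrite mxE.
by rewrite /kn !id1 (negPf ik) (negPf il) (negPf jk) (negPf jl) /=; ring.
Qed.

(** By [Ric_lmap] and [scal_lmap], l_{a,b} scales the trace-free part of Ric by 1 + (n-2)b and scal
    by 1 + 2(n-1)a; under composition these factors multiply. *)
Lemma lmap_comp a b a' b' (S : tensor4 R n) : (0 < n)%N ->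
  lmap a b (lmap a' b' S) =
  lmap (a + a' + 2 * (n%:R - 1) * a * a') (b + b' + (n%:R - 2) * b * b') S.
Proof.
move=> n_gt0; have n0 : n%:R != 0 :> R by rewrite pnatr_eq0 -lt0n.
apply/funext => i; apply/funext => j; apply/funext => k; apply/funext => l.
rewrite {1}/lmap Ric_lmap// scal_lmap// /lmap /tensor_I /kn !mxE.
rewrite -!(mulr_natr (_ * scal S)).
by field.
Qed.

Lemma Ric_sym (S : tensor4 R n) : S2so S -> (Ric S)^T = Ric S.
Proof.
move=> [_ Ss]; apply/matrixP => i k; rewrite !mxE.
by apply: eq_bigr => p _; rewrite Ss.
Qed.

Lemma CB_lmap a b (S : tensor4 R n) : CB S -> CB (lmap a b S).
Proof.
move=> [hS bS]; have [Sa Ss] := hS.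
have Rs i k : Ric S i k = Ric S k i by rewrite -[in LHS](Ric_sym hS) mxE.
have ds i k : (1%:M : 'M[R]_n) i k = 1%:M k i by rewrite !mxE eq_sym.
split; first split.
- move=> i j k l; rewrite /lmap /tensor_I /kn Sa; ring.
- move=> i j k l; rewrite /lmap /tensor_I /kn Ss (Rs k i) (Rs l j) (Rs k j) (Rs l i).
  by rewrite (ds k i) (ds l j) (ds k j) (ds l i); ring.
move=> i j k l.
have -> : lmap a b S i j k l + lmap a b S j k i l + lmap a b S k i j l =
  (S i j k l + S j k i l + S k i j l) +
  b * (kn (Ric S) 1%:M i j k l + kn (Ric S) 1%:M j k i l + kn (Ric S) 1%:M k i j l)
  + 2 * (a - b) / n%:R * scal S * 2^-1 *
    (kn 1%:M 1%:M i j k l + kn 1%:M 1%:M j k i l + kn 1%:M 1%:M k i j l).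
  by rewrite /lmap /tensor_I; ring.
rewrite bS /kn (Rs k i) (Rs k j) (Rs j i) (ds k i) (ds k j) (ds j i); ring.
Qed.

End Trace.

(** * Numerical values at b = 1/18 and b = 1/40 *)

Section Constants.
Variable R : realType.

Lemma gamma_bmax2 : gamma (bmax2 R) = 1 / 41.
Proof. by rewrite /gamma /bmax2; field. Qed.

Lemma a_bmax2 : a_ (bmax2 R) = 49 / 738.
Proof. by rewrite /a_ /bmax2; field. Qed.

Lemma at_btmax2 : at_ (btmax2 R) = 43 / 1600.
Proof. by rewrite /at_ /btmax2; field. Qed.

Lemma omega_bmax2_le : omega (bmax2 R) <= 533 / 100.
Proof.
have rhoE : rho (bmax2 R) = 31 / 712.
  rewrite /rho a_bmax2 gamma_bmax2 /bmax2.
  have -> : 1 - 2 * (1 / 18) = 8 / 9 :> R by field.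
  have -> : 1 + 2 * (8%:R - 1) * (49 / 738) = 712 / 369 :> R by field.
  have -> : 8%:R ^+ 2 * (1 / 18) ^+ 2 - 2 * (8%:R - 1) * (49 / 738 - 1 / 18) * (8 / 9)
    = 208 / 3321 :> R by lra.
  have -> : 2 * (8%:R - 1) * (1 + 1 / 41) * (208 / 3321) / (8%:R ^+ 2 * (712 / 369))
    = 637 / (24 * 41 * 89) :> R by lra.
  by lra.
rewrite /omega rhoE /bmax2.
set y := _ * (_ / _).
(* The square root of [y] is about 5.327. *)
have /ler_wsqrtr : y <= (533 / 100) ^+ 2 by rewrite /y mulrA ler_pdivrMr; lra.
rewrite sqrtr_sqr ger0_norm; last by lra.
have := sqrtr_ge0 y; rewrite /epsilon; move: (Num.sqrt y) => s; lra.
Qed.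

Lemma sqrt_at_btmax2_ge : 23 / 100 <= Num.sqrt (2 * at_ (btmax2 R)).
Proof.
(* The square root of 43/800 is about 0.2318. *)
have /ler_wsqrtr : (23 / 100) ^+ 2 <= 2 * at_ (btmax2 R) :> R.
  by rewrite at_btmax2; lra.
by rewrite sqrtr_sqr ger0_norm; lra.
Qed.

(** Weighted AM-GM, by completing a square. The factor [Num.sqrt w ^+ 2] in place of w lets the
    bound hold for every sign of w. *)
Lemma sqrtM3_le (w s x t : R) : 0 < t -> 0 <= s -> 0 <= x ->
  Num.sqrt w * Num.sqrt s * Num.sqrt x <= (t * (Num.sqrt w ^+ 2) * s + x / t) / 2.
Proof.
move=> t0 s0 x0.
rewrite -[in leRHS](sqr_sqrtr s0) -[in X in _ <= (_ + X) / _](sqr_sqrtr x0).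
move: (Num.sqrt w) (Num.sqrt s) (Num.sqrt x) => a b c.
have -> : (t * a ^+ 2 * b ^+ 2 + c ^+ 2 / t) / 2 =
   a * b * c + (t * a * b - c) ^+ 2 / (2 * t) by field; rewrite gt_eqF.
by rewrite lerDl divr_ge0 ?sqr_ge0// mulr_ge0// ltW.
Qed.

End Constants.

Local Notation o k := (@Ordinal 8 k isT).

Lemma sum8 (V : nmodType) (F : 'I_8 -> V) :
  \sum_p F p = F (o 0) + F (o 1) + F (o 2) + F (o 3)
               + (F (o 4) + F (o 5) + F (o 6) + F (o 7)).
Proof.
rewrite !big_ord_recl big_ord0 addr0 !addrA.
by do !congr (_ + _); congr F; exact: val_inj.
Qed.

(** * Estimates for U in E(1/18) in a fixed orthonormal frame *)

Section Pinching.
Variables (R : realType) (U T : tensor4 R 8) (f : 'M[R]_8).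
Hypotheses (bU : CB U) (hT : S2so T) (T_ge0 : nonneg_def T).
Hypothesis pW : CPIC (tensor_sub U T).
Hypothesis Ric2_ge0 : forall e : 'M[R]_(2, 8), orthonormal e ->
  0 <= Ric_in e U i1 i1 + Ric_in e U i2 i2 + 2 * gamma (bmax2 R) / 8%:R * scal U.
Hypothesis Ric_gap : forall e : 'M[R]_8, orthonormal e ->
  let T' := in_frame e T in
  Ric_in e U i2 i2 - Ric_in e U i1 i1 <=
    Num.sqrt (omega (bmax2 R)) * Num.sqrt (scal U) *
    Num.sqrt (\sum_(p < 8 | (2 <= p)%N) (T' i1 p i1 p + T' i2 p i2 p)).
Hypothesis orth_f : orthonormal f.

Let hW : S2so (tensor_sub U T). Proof. by case: pW. Qed.
Let w i j := in_frame f (tensor_sub U T) i j i j.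
Let t i j := in_frame f T i j i j.
Let r i := Ric_in f U i i.

Let wC i j : w i j = w j i.
Proof.
by rewrite /w !in_frameE (ev_antisym hW) (ev_pair hW) (ev_antisym hW) opprK.
Qed.

Let tC i j : t i j = t j i.
Proof.
by rewrite /t !in_frameE (ev_antisym hT) (ev_pair hT) (ev_antisym hT) opprK.
Qed.

Let wii i : w i i = 0.
Proof.
have := ev_antisym hW (row i f) (row i f) (row i f) (row i f).
by rewrite /w in_frameE; lra.
Qed.

Let tii i : t i i = 0.
Proof.
have := ev_antisym hT (row i f) (row i f) (row i f) (row i f).
by rewrite /t in_frameE; lra.
Qed.

Let uE i j k l : in_frame f U i j k l =
  in_frame f (tensor_sub U T) i j k l + in_frame f T i j k l.
Proof. by rewrite !in_frameE ev_sub subrK. Qed.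

Let t_ge0 i j : 0 <= t i j.
Proof.
have := ev_psd hT T_ge0 0 (row i f) (row j f) (row i f) (row j f).
by rewrite /t in_frameE expr0n/=; lra.
Qed.

(** Averaging over x = 1 and x = -1, that is, over the sign of the fourth vector, cancels the mixed
    PIC terms. The fifth index q only serves [CPIC_rotated] and enters with coefficient y = 0. *)
Let pic i j k l : uniq [:: i; j; k; l] -> 0 <= w i k + w i l + w j k + w j l.
Proof.
move=> ijkl; have [q] : exists q, q \notin [:: i; j; k; l].
  apply/existsP; apply: contraT => /existsPn all_in.
  have : (#|'I_8| <= #|[:: i; j; k; l]|)%N.
    apply: subset_leq_card; apply/fintype.subsetP => q _.
    by rewrite -[_ \in _]negbK all_in.
  by rewrite card_ord => /leq_trans/(_ (card_size _)).
move=> q_notin; have ijklq : uniq [:: i; j; k; l; q].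
  by rewrite -[[:: i; _; _; _; _]]/(rcons [:: i; j; k; l] q) rcons_uniq q_notin.
have := CPIC_rotated (x := 1) (y := 0) orth_f pW ijklq.
have := CPIC_rotated (x := -1) (y := 0) orth_f pW ijklq.
rewrite sqrrN !expr1n expr0n/= addr0 => /(_ erefl) + /(_ erefl).
by rewrite -!/(w _ _); lra.
Qed.

(** Condition (3) in the frame, with 1/164 = 2 gamma(1/18) / 8. *)
Let Ric2 i j : i != j -> 0 <= r i + r j + scal U / 164.
Proof.
move=> ij; pose g (a : 'I_2) := if a == i1 then i else j.
have g_inj : injective g.
  rewrite /g => -[[|[|//]] ?] [[|[|//]] ?] //= E; try exact: val_inj.
    by rewrite E eqxx in ij.
  by rewrite E eqxx in ij.
have := Ric2_ge0 (rowsub_orthonormal orth_f g_inj).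
by rewrite gamma_bmax2 !Ric_in_rowsub -!/(r _) /g/=; lra.
Qed.

(** [Ric2] summed over four disjoint pairs gives (1 + 4/164) scal U >= 0. *)
Let scal_ge0 : 0 <= scal U.
Proof.
have := @Ric2 (o 0) (o 1) isT; have := @Ric2 (o 2) (o 3) isT.
have := @Ric2 (o 4) (o 5) isT; have := @Ric2 (o 6) (o 7) isT.
by have := scal_in_frame U orth_f; rewrite sum8 -!/(r _); lra.
Qed.

(** Condition (4) in the frame relabelled by g, linearised by [sqrtM3_le] at t = 1/28; 533/2800 is
    the bound 533/100 on omega divided by 28. *)
Let gap (g : 'I_8 -> 'I_8) : injective g ->
  r (g i2) - r (g i1) <= (533 / 2800 * scal U
    + 28 * \sum_(p < 8 | (2 <= p)%N) (t (g i1) (g p) + t (g i2) (g p))) / 2.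
Proof.
move=> g_inj; have /= := Ric_gap (rowsub_orthonormal orth_f g_inj).
rewrite (eq_bigr (fun p => t (g i1) (g p) + t (g i2) (g p))); last first.
  by move=> p _; rewrite !in_frame_rowsub.
rewrite !Ric_in_rowsub => /le_trans; apply.
set X := \sum_(p < 8 | _) _.
have X0 : 0 <= X by apply: sumr_ge0 => p _; rewrite addr_ge0 ?t_ge0.
apply: le_trans (@sqrtM3_le _ _ _ _ (1 / 28) _ scal_ge0 X0) _; first by lra.
have : Num.sqrt (omega (bmax2 R)) ^+ 2 <= 533 / 100.
  (* For negative omega the square root is 0 by convention, and the bound is immediate. *)
  have [w0|w0] := leP 0 (omega (bmax2 R)).
    by rewrite sqr_sqrtr// omega_bmax2_le.
  by rewrite ler0_sqrtr ?ltW// expr0n/=; lra.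
move: (Num.sqrt _ ^+ 2) => s s_le.
have := ler_wpM2r scal_ge0 s_le; rewrite -/X; nra.
Qed.

(* Indices are grouped as {0, 1}, {2}, {3} and {4, ..., 7}. *)
Let s01 (h : 'I_8 -> 'I_8 -> R) := h (o 0) (o 1).
Let s02 (h : 'I_8 -> 'I_8 -> R) := h (o 0) (o 2) + h (o 1) (o 2).
Let s03 (h : 'I_8 -> 'I_8 -> R) := h (o 0) (o 3) + h (o 1) (o 3).
Let s23 (h : 'I_8 -> 'I_8 -> R) := h (o 2) (o 3).
Let sq (h : 'I_8 -> 'I_8 -> R) i :=
  h i (o 4) + h i (o 5) + h i (o 6) + h i (o 7).
Let s0q h := sq h (o 0) + sq h (o 1).
Let sqq (h : 'I_8 -> 'I_8 -> R) :=
  h (o 4) (o 5) + h (o 4) (o 6) + h (o 4) (o 7)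
  + h (o 5) (o 6) + h (o 5) (o 7) + h (o 6) (o 7).

Local Notation pic_ i j k l := (@pic (o i) (o j) (o k) (o l) isT).

(** The linear form to be bounded is invariant under swapping 0 and 1 and under permuting 4, ..., 7.
    The coordinate PIC inequalities are therefore summed over these symmetries; p and q in the names
    run over 4, ..., 7. *)
Let pic_01_23 : 0 <= s02 w + s03 w.
Proof.
have := pic_ 0 1 2 3.
by rewrite /s01 /s02 /s03 /s23 /s0q /sqq /sq; lra.
Qed.

Let pic_01_2q : 0 <= 4 * s02 w + s0q w.
Proof.
have := pic_ 0 1 2 4. have := pic_ 0 1 2 5. have := pic_ 0 1 2 6.
have := pic_ 0 1 2 7.
by rewrite /s01 /s02 /s03 /s23 /s0q /sqq /sq; lra.
Qed.

Let pic_02_13 : 0 <= 2 * s01 w + s02 w + s03 w + 2 * s23 w.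
Proof.
have := pic_ 0 2 1 3. have := pic_ 1 2 0 3.
rewrite ?(wC (o 1) (o 0)) ?(wC (o 2) (o 0)) ?(wC (o 2) (o 1)).
by rewrite /s01 /s02 /s03 /s23 /s0q /sqq /sq; lra.
Qed.

Let pic_02_1q : 0 <= 8 * s01 w + 4 * s02 w + s0q w + 2 * sq w (o 2).
Proof.
have := pic_ 0 2 1 4. have := pic_ 0 2 1 5. have := pic_ 0 2 1 6.
have := pic_ 0 2 1 7. have := pic_ 1 2 0 4. have := pic_ 1 2 0 5.
have := pic_ 1 2 0 6. have := pic_ 1 2 0 7.
rewrite ?(wC (o 1) (o 0)) ?(wC (o 2) (o 0)) ?(wC (o 2) (o 1)).
by rewrite /s01 /s02 /s03 /s23 /s0q /sqq /sq; lra.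
Qed.

Let pic_03_1q : 0 <= 8 * s01 w + 4 * s03 w + s0q w + 2 * sq w (o 3).
Proof.
have := pic_ 0 3 1 4. have := pic_ 0 3 1 5. have := pic_ 0 3 1 6.
have := pic_ 0 3 1 7. have := pic_ 1 3 0 4. have := pic_ 1 3 0 5.
have := pic_ 1 3 0 6. have := pic_ 1 3 0 7.
rewrite ?(wC (o 1) (o 0)) ?(wC (o 3) (o 0)) ?(wC (o 3) (o 1)).
by rewrite /s01 /s02 /s03 /s23 /s0q /sqq /sq; lra.
Qed.

Let pic_0p_1q : 0 <= 12 * s01 w + 3 * s0q w + 2 * sqq w.
Proof.
have := pic_ 0 4 1 5. have := pic_ 0 4 1 6. have := pic_ 0 4 1 7.
have := pic_ 0 5 1 4. have := pic_ 0 5 1 6. have := pic_ 0 5 1 7.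
have := pic_ 0 6 1 4. have := pic_ 0 6 1 5. have := pic_ 0 6 1 7.
have := pic_ 0 7 1 4. have := pic_ 0 7 1 5. have := pic_ 0 7 1 6.
rewrite ?(wC (o 4) (o 1)) ?(wC (o 5) (o 1)) ?(wC (o 5) (o 4)) ?(wC (o 6) (o 1)).
rewrite ?(wC (o 6) (o 4)) ?(wC (o 6) (o 5)) ?(wC (o 7) (o 1)) ?(wC (o 7) (o 4)).
rewrite ?(wC (o 7) (o 5)) ?(wC (o 7) (o 6)).
by rewrite /s01 /s02 /s03 /s23 /s0q /sqq /sq; lra.
Qed.

Let pic_pq_pq : 0 <= sqq w.
Proof.
have := pic_ 4 5 6 7. have := pic_ 4 6 5 7. have := pic_ 4 7 5 6.
rewrite ?(wC (o 6) (o 5)) ?(wC (o 7) (o 5)) ?(wC (o 7) (o 6)).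
by rewrite /s01 /s02 /s03 /s23 /s0q /sqq /sq; lra.
Qed.

Let ric i : r i = \sum_p (w i p + t i p).
Proof. by rewrite /r Ric_in_frame//; apply: eq_bigr => p _; rewrite uE. Qed.

Let ric01 : r (o 0) + r (o 1) = 2 * s01 w + s02 w + s03 w + s0q w
  + (2 * s01 t + s02 t + s03 t + s0q t).
Proof.
rewrite !ric !sum8 !wii !tii ?(wC (o 1) (o 0)) ?(tC (o 1) (o 0)).
by rewrite /s01 /s02 /s03 /s0q /sq; lra.
Qed.

Let ric2 : r (o 2) = s02 w + s23 w + sq w (o 2) + (s02 t + s23 t + sq t (o 2)).
Proof.
rewrite !ric !sum8 !wii !tii ?(wC (o 2) (o 0)) ?(tC (o 2) (o 0)).
rewrite ?(wC (o 2) (o 1)) ?(tC (o 2) (o 1)).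
by rewrite /s02 /s23 /sq; lra.
Qed.

Let sum_sym h : (forall i j, h i j = h j i) -> (forall i, h i i = 0) ->
  \sum_i \sum_p h i p = 2 * (s01 h + s02 h + s03 h + s0q h + s23 h
    + sq h (o 2) + sq h (o 3) + sqq h).
Proof.
move=> hC h0; rewrite !sum8 !h0.
rewrite (hC (o 1) (o 0)) (hC (o 2) (o 0)) (hC (o 2) (o 1)) (hC (o 3) (o 0))
  (hC (o 3) (o 1)) (hC (o 3) (o 2)) (hC (o 4) (o 0)) (hC (o 4) (o 1))
  (hC (o 4) (o 2)) (hC (o 4) (o 3)) (hC (o 5) (o 0)) (hC (o 5) (o 1))
  (hC (o 5) (o 2)) (hC (o 5) (o 3)) (hC (o 5) (o 4)) (hC (o 6) (o 0))
  (hC (o 6) (o 1)) (hC (o 6) (o 2)) (hC (o 6) (o 3)) (hC (o 6) (o 4))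
  (hC (o 6) (o 5)) (hC (o 7) (o 0)) (hC (o 7) (o 1)) (hC (o 7) (o 2))
  (hC (o 7) (o 3)) (hC (o 7) (o 4)) (hC (o 7) (o 5)) (hC (o 7) (o 6)).
by rewrite /s01 /s02 /s03 /s23 /s0q /sqq /sq; ring.
Qed.

Let scalE : scal U =
  2 * (s01 w + s02 w + s03 w + s0q w + s23 w + sq w (o 2) + sq w (o 3) + sqq w)
  + 2 * (s01 t + s02 t + s03 t + s0q t + s23 t + sq t (o 2) + sq t (o 3) + sqq t).
Proof.
rewrite (scal_in_frame U orth_f) -!sum_sym// -big_split/=.
by apply: eq_bigr => i _; rewrite -/(r i) ric big_split.
Qed.

(** Sum of [gap] for the index pairs (0, 2) and (1, 2), which the permutations g1 and g2 bring to
    the first two places. *)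
Let gap2 : 2 * r (o 2) - r (o 0) - r (o 1) <= 533 / 2800 * scal U
  + 14 * (2 * s01 t + s02 t + s03 t + s0q t + 2 * s23 t + 2 * sq t (o 2)).
Proof.
pose g1 := [:: o 0; o 2; o 1; o 3; o 4; o 5; o 6; o 7].
pose g2 := [:: o 1; o 2; o 0; o 3; o 4; o 5; o 6; o 7].
have inj (g : seq 'I_8) : size g = 8 -> uniq g ->
    injective (fun p : 'I_8 => nth (o 0) g p).
  by move=> sg ug p q /eqP; rewrite nth_uniq ?sg// => /eqP/val_inj.
have := gap (inj g1 erefl isT); rewrite big_mkcond/= sum8/=.
have := gap (inj g2 erefl isT); rewrite big_mkcond/= sum8/=.
rewrite ?(tC (o 1) (o 0)) ?(tC (o 2) (o 0)) ?(tC (o 2) (o 1)).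
by rewrite /s01 /s02 /s03 /s23 /s0q /sq; lra.
Qed.

(** What l_{a',b'} and the Ricci term add to the curvature terms of U in (ii) at lambda = 0, with a'
    - b' lowered to 1/500 and sqrt(2 at) to 23/100. Here b' = 11/414, 80/69 = 1 + 6 b', and 7/2000 =
    (7/4) / 500. *)
Let base := 11 / 414 * (r (o 0) + r (o 1) + 2 * r (o 2)) + scal U / 1000
  + 23 / 100 * (80 / 69 * (r (o 0) + r (o 1)) + 2 * (11 / 414 + 7 / 2000) * scal U).

(* By linear programming; the minimum over scal U = 1 is about 0.0028. *)
Let mid_ge0 : 0 <= (s02 w - s03 w) / 8 - 3 / 16 * s0q w + base.
Proof.
have := (pic_01_23, pic_01_2q, pic_02_13, pic_02_1q, pic_03_1q, pic_0p_1q, pic_pq_pq).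
move=> [[[[[[h0 h1] h2] h3] h4] h5] h6].
have t01 : 0 <= s01 t by exact: t_ge0.
have t02 : 0 <= s02 t by rewrite addr_ge0.
have t03 : 0 <= s03 t by rewrite addr_ge0.
have sq_ge0 i : 0 <= sq t i by rewrite !addr_ge0.
have t0q : 0 <= s0q t by rewrite addr_ge0.
have t2q := sq_ge0 (o 2); have t3q := sq_ge0 (o 3).
have t23 : 0 <= s23 t by exact: t_ge0.
have tqq : 0 <= sqq t by rewrite !addr_ge0.
move: h0 h1 h2 h3 h4 h5 h6 t01 t02 t03 t0q t2q t3q t23 tqq {sq_ge0}.
move: gap2 ric01 ric2 scalE scal_ge0; rewrite /base.
move: (r _) (r _) (r _) (scal U) => r0 r1 r2 s.
move: (s01 w) (s02 w) (s03 w) (s0q w) (s23 w) (sq w _) (sq w _) (sqq w).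
move: (s01 t) (s02 t) (s03 t) (s0q t) (s23 t) (sq t _) (sq t _) (sqq t).
move=> *; lra.
Qed.

Let u := in_frame f U.

(* The weight 3/4 of the rotated frames could be anything between 0.6 and 0.9;
   rotated frames alone do not suffice. *)
Let mixed (x : R) : 0 <= x <= 1 ->
  (1 - x) / 4 * (s02 w - x * s03 w) - 3 / 16 * (1 - x ^+ 2) * s0q w <=
  u (o 0) (o 2) (o 0) (o 2) + x ^+ 2 * u (o 0) (o 3) (o 0) (o 3)
  + u (o 1) (o 2) (o 1) (o 2) + x ^+ 2 * u (o 1) (o 3) (o 1) (o 3)
  - 2 * x * u (o 0) (o 1) (o 2) (o 3).
Proof.
move=> /andP[x0 x1].
(* These two inequalities make the total contribution of T to the right-hand side nonnegative,
   leaving only W to estimate. *)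
have := ev_psd hT T_ge0 x (row (o 0) f) (row (o 2) f) (row (o 3) f) (row (o 1) f).
have := ev_psd hT T_ge0 x (row (o 1) f) (row (o 2) f) (row (o 0) f) (row (o 3) f).
rewrite [ev T (row (o 1) f) (row (o 2) f) (row (o 0) f) (row (o 3) f)](ev_pair hT).
have hU := bU.1.
(* W and T need not satisfy Bianchi separately, so the identity is applied to U before splitting; it
   yields the two mixed terms of relaxed PIC. *)
have bianchi : u (o 0) (o 1) (o 2) (o 3) =
    - (u (o 0) (o 2) (o 3) (o 1) + u (o 0) (o 3) (o 1) (o 2)).
  have := ev_bianchi bU (row (o 0) f) (row (o 1) f) (row (o 2) f) (row (o 3) f).
  rewrite /u !in_frameE [ev U _ (row (o 2) f) (row (o 0) f) _](ev_pair hU).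
  by rewrite (ev_antisym hU (row (o 2) f)) (ev_pair hU _ (row (o 2) f))
     (ev_antisym hU (row (o 1) f)) (ev_pair hU (row (o 3) f)); lra.
rewrite bianchi /u !uE -!in_frameE -/(t _ _) -!/(w _ _).
rewrite -!/(t _ _) (tC (o 3) (o 1)).
set tv1 := in_frame f T _ _ _ _; set tv2 := in_frame f T _ _ _ _.
pose v := in_frame f (tensor_sub U T) (o 0) (o 2) (o 3) (o 1)
  + in_frame f (tensor_sub U T) (o 0) (o 3) (o 1) (o 2).
have iso y q : uniq [:: o 0; o 1; o 2; o 3; q] -> 0 <= y <= 1 ->
    0 <= s02 w + y ^+ 2 * s03 w + (1 - y ^+ 2) * (w (o 0) q + w (o 1) q) + 2 * y * v.
  move=> hq /andP[y0 y1].
  have y2 : 0 <= 1 - y ^+ 2 by rewrite subr_ge0 expr_le1.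
  have := CPIC_rotated orth_f pW hq (_ : y ^+ 2 + Num.sqrt (1 - y ^+ 2) ^+ 2 = 1).
  by rewrite !sqr_sqrtr// subrKC; apply.
have x01 : 0 <= x <= 1 by rewrite x0.
have := iso x (o 4) isT x01; have := iso x (o 5) isT x01.
have := iso x (o 6) isT x01; have := iso x (o 7) isT x01.
(* The four inequalities at x enter with weight 3/16 each, and the coordinate one, multiplied by x,
   with weight 1/4. The coefficient of v is then (3/4) 2x + (1/4) 2x = 2x, as required. *)
have := iso 1 (o 4) isT; rewrite ler01 lexx => /(_ isT) /(mulr_ge0 x0).
rewrite /s02 /s03 /s0q /sq /v => *; lra.
Qed.

(** This is (ii) for l_{a',b'}(U) written out in terms of U, with lambda = x, b' = 11/414, d = a' -
    b' and sigma = sqrt(2 at). *)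
Lemma weighted_pic_ge0 (d sigma x : R) :
  1 / 500 <= d -> 23 / 100 <= sigma -> 0 <= x <= 1 ->
  0 <= u (o 0) (o 2) (o 0) (o 2) + x ^+ 2 * u (o 0) (o 3) (o 0) (o 3)
    + u (o 1) (o 2) (o 1) (o 2) + x ^+ 2 * u (o 1) (o 3) (o 1) (o 3)
    - 2 * x * u (o 0) (o 1) (o 2) (o 3)
    + 11 / 414 * ((1 + x ^+ 2) * (r (o 0) + r (o 1))
                  + 2 * r (o 2) + 2 * x ^+ 2 * r (o 3))
    + (1 + x ^+ 2) / 2 * d * scal U
    + sigma * (1 - x ^+ 2) * (80 / 69 * (r (o 0) + r (o 1))
                              + 2 * (11 / 414 + 7 / 4 * d) * scal U).
Proof.
move=> d_ge s_ge x01; have [x0 x1] := andP x01.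
have x2 : 0 <= 1 - x ^+ 2 by rewrite subr_ge0 expr_le1.
have r01 := @Ric2 (o 0) (o 1) isT; have r23 := @Ric2 (o 2) (o 3) isT.
(* The value at x = 1: by [Ric2] the Ricci terms lose at most 44 / (414 * 164) scal U, which is
   below scal U / 500. *)
have end_ge0 : 0 <= 11 / 414 * (2 * (r (o 0) + r (o 1)) + 2 * (r (o 2) + r (o 3)))
    + 1 / 500 * scal U by have := scal_ge0; lra.
apply: le_trans (_ : 0 <=
  (1 - x) / 4 * (s02 w - x * s03 w) - 3 / 16 * (1 - x ^+ 2) * s0q w
   + (1 - x ^+ 2) * base + x ^+ 2 * (11 / 414 * (2 * (r (o 0) + r (o 1))
     + 2 * (r (o 2) + r (o 3))) + 1 / 500 * scal U)) _.
  (* Separating the sum and the difference of s02 w and s03 w isolates the factor 1 - x^2 of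
     [mid_ge0] and leaves a square times [pic_01_23]. *)
  have -> : (1 - x) / 4 * (s02 w - x * s03 w) - 3 / 16 * (1 - x ^+ 2) * s0q w
      + (1 - x ^+ 2) * base =
    (1 - x ^+ 2) * ((s02 w - s03 w) / 8 - 3 / 16 * s0q w + base)
    + (1 - x) ^+ 2 / 8 * (s02 w + s03 w) by field.
  apply: addr_ge0; last exact: mulr_ge0 (sqr_ge0 x) end_ge0.
  apply: addr_ge0; first exact: mulr_ge0 x2 mid_ge0.
  by apply: mulr_ge0 pic_01_23; rewrite divr_ge0 ?sqr_ge0.
have := mixed x01; rewrite /base.
(* d and sigma may be lowered to 1/500 and 23/100 because they multiply nonnegative quantities, by
   [scal_ge0] and [Ric_ge0]. *)
have dS : (1 + x ^+ 2) / 2 * (1 / 500) * scal U <= (1 + x ^+ 2) / 2 * d * scal U.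
  rewrite ler_wpM2r ?scal_ge0// ler_wpM2l//; have := sqr_ge0 x; lra.
have Ric_ge0 : 0 <= 80 / 69 * (r (o 0) + r (o 1)) + 2 * (11 / 414 + 7 / 2000) * scal U.
  by have := scal_ge0; lra.
have sS : 23 / 100 * (1 - x ^+ 2) * (80 / 69 * (r (o 0) + r (o 1))
      + 2 * (11 / 414 + 7 / 2000) * scal U) <=
    sigma * (1 - x ^+ 2) * (80 / 69 * (r (o 0) + r (o 1))
      + 2 * (11 / 414 + 7 / 4 * d) * scal U).
  apply: ler_pM => //; first by rewrite mulr_ge0//; lra.
    by rewrite ler_wpM2r.
  rewrite lerD2l ler_wpM2r ?scal_ge0//; lra.
move: dS sS; rewrite -/u; move=> *; lra.
Qed.

End Pinching.

(** * Equality of the two cones *)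

(* l_{at(1/40), 1/40} o l_{a_rel, 11/414} = l_{a(1/18), 1/18} *)
Definition a_rel (R : realType) : R := (49 / 738 - 43 / 1600) / (1 + 14 * (43 / 1600)).

Lemma a_rel_ge (R : realType) : 1 / 500 <= a_rel R - 11 / 414.
Proof.
rewrite lerBrDr /a_rel ler_pdivlMr; lra.
Qed.

Lemma lmap_btmax2 (R : realType) (U : tensor4 R 8) :
  lmap (at_ (btmax2 R)) (btmax2 R) (lmap (a_rel R) (11 / 414) U) =
  lmap (a_ (bmax2 R)) (bmax2 R) U.
Proof.
rewrite lmap_comp// at_btmax2 a_bmax2; congr lmap; last by rewrite /btmax2 /bmax2; lra.
have : a_rel R * (1 + 14 * (43 / 1600)) = 49 / 738 - 43 / 1600.
  by rewrite /a_rel divfK// gt_eqF//; lra.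
lra.
Qed.

Lemma Et_lmap (R : realType) (U : tensor4 R 8) :
  E (bmax2 R) U -> Et (btmax2 R) (lmap (a_rel R) (11 / 414) U).
Proof.
move=> EU; have [bU [T [hT [T_ge0 pW Ric2 gap]]]] := EU.
split; first exact: CB_lmap.
  by rewrite lmap_btmax2; exists U.
move=> e x oe x01.
have [g orth_f] := @orthonormal_completion R 4 8 4 e oe isT.
pose f : 'M[R]_8 := col_mx e g.
have eE : e = rowsub (@lshift 4 4) f by apply/matrixP => i j; rewrite mxE col_mxEu.
have l0 : lshift 4 (0 : 'I_4) = o 0 by exact: val_inj.
have l1 : lshift 4 (1 : 'I_4) = o 1 by exact: val_inj.
have l2 : lshift 4 (2%:R : 'I_4) = o 2 by exact: val_inj.
have l3 : lshift 4 (3%:R : 'I_4) = o 3 by exact: val_inj.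
have := weighted_pic_ge0 bU hT T_ge0 pW Ric2 gap orth_f (a_rel_ge R)
  (sqrt_at_btmax2_ge R) x01.
rewrite -/f eE /= !in_frame_rowsub !Ric_in_rowsub l0 l1 l2 l3.
rewrite !in_frame_lmap// !Ric_in_lmap// !kn_id_sectional// !kn_id_distinct//.
rewrite -!Ric_inE !mxE !eqxx; congr (_ <= _).
move: (Ric_in _ _ _ _) (Ric_in _ _ _ _) (Ric_in _ _ _ _) (Ric_in _ _ _ _).
move: (scal U) (a_rel R) (Num.sqrt _) => s a c ra rb rc rd.
by rewrite /=; field.
Qed.

Theorem theorem3p6 (R : realType) : C (bmax2 R) = Ct (btmax2 R).
Proof.
(* The inclusion of the second cone in the first is condition (i) itself. *)
apply/seteqP; split=> [_ [U EU <-]|_ [S [_ CS _] <-]//].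
exists (lmap (a_rel R) (11 / 414) U); first exact: Et_lmap.
exact: lmap_btmax2.
Qed.
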